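(* Suppose a dynamic data structure problem has a solution (a data structure in the cell probe model with $w$-bit cells) with worst-case update time $t_u$ and worst-case query time $t_q$ (measured in cell probes). Then its static, fully persistent version with a total of $m$ updates has $(s, w, t)$-certificates for $s = O(m \cdot t_u)$ and $t = O(t_q)$, provided that $w = \Omega(\lg m)$.
   Context: A data structure problem is a function $f : \mathcal{Q} \times \mathcal{D} \to \mathcal{Z}$ (queries, databases, results). For a code $T : \mathcal{D} \to (\{0,1\}^w)^s$, write $T_d(i)$ for the $i$-th of the $s$ cells ($w$-bit strings) of $T(d)$, and for $P = \{i_1,\dots,i_k\} \subseteq \{1,\dots,s\}$ write $T_d(P)$ for the sequence $(i_1, T_d(i_1)),\dots,(i_k, T_d(i_k))$. The problem $f$ has $(s,w,t)$-certificates if there exist a code $T : \mathcal{D} \to (\{0,1\}^w)^s$ and a verifier $V$ such that for all $q \in \mathcal{Q}$, $d \in \mathcal{D}$ and all $P \subseteq \{1,\dots,s\}$ with $|P| = t$, either $V(q, T_d(P)) = f(q,d)$ or $V(q, T_d(P)) = \bot$ (with $\bot \notin \mathcal{Z}$), and for at least one such $P$, $V(q, T_d(P)) = f(q,d)$. Given a dynamic problem (supporting updates and queries), its static, fully persistent version is the following static data structure problem: the database is a rooted tree (the version tree) in which every node carries a sequence of update operations (the total number of updates over all nodes being $m$); queries are pairs $(q,u)$ with $q$ a query of the dynamic problem and $u$ a node of the version tree, and the answer is the result of executing $q$ after performing, starting from the initial state, the sequence of updates found on the path from the root to $u$ (in order).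
   Formalization: The version tree is assumed to have O(m) nodes (automatic if every node carries at least one update; the claim fails with unboundedly many update-free nodes), and memory cells are addressed by w-bit words, so the data structure has 2^w cells. *)

(* Defs.v *)
From mathcomp Require Import all_boot.

Set Implicit Arguments.
Unset Strict Implicit.
Unset Printing Implicit Defensive.

Definition word (w : nat) : Type := w.-tuple bool.

(* T_d(P); the cells are listed by increasing index. *)
Definition probed (s w : nat) (T : s.-tuple (word w)) (P : {set 'I_s}) :
    seq ('I_s * word w) :=
  [seq (i, tnth T i) | i <- enum P].

(* [None] is the value ⊥ of the verifier. *)
Definition has_certificates (Q D Z : Type) (f : Q -> D -> Z) (s w t : nat) :
    Prop :=
  exists (T : D -> s.-tuple (word w))
         (V : Q -> seq ('I_s * word w) -> option Z),
  forall (q : Q) (d : D),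
    (forall P : {set 'I_s}, #|P| = t ->
       V q (probed (T d) P) = Some (f q d) \/ V q (probed (T d) P) = None) /\
    (exists P : {set 'I_s},
       #|P| = t /\ V q (probed (T d) P) = Some (f q d)).

Record dynamic_problem := DynamicProblem {
  update : Type;
  query : Type;
  result : Type;
  state : Type;
  init_state : state;
  apply_update : state -> update -> state;
  answer : query -> state -> result
}.

(* Addresses are themselves words: the memory has 2 ^ w cells of w bits. *)
Definition memory (w : nat) : Type := word w -> word w.

(* Adaptive cell-probe algorithms: local computation is free and arbitrary, so
   an algorithm is a tree of probes branching on the contents that are read. *)
Inductive prog (w : nat) (A : Type) : Type :=
| Ret of A
| Read of word w & (word w -> prog w A)
| Write of word w & word w & prog w A.

Fixpoint exec (w : nat) (A : Type) (p : prog w A) (M : memory w) :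
    A * memory w :=
  match p with
  | Ret x => (x, M)
  | Read a k => exec (k (M a)) M
  | Write a c p' => exec p' [eta M with a |-> c]
  end.

Fixpoint probes (w : nat) (A : Type) (p : prog w A) (M : memory w) : nat :=
  match p with
  | Ret _ => 0
  | Read a k => (probes (k (M a)) M).+1
  | Write a c p' => (probes p' [eta M with a |-> c]).+1
  end.

Record data_structure (X : dynamic_problem) (w : nat) := DataStructure {
  init_memory : memory w;
  update_prog : update X -> prog w unit;
  query_prog : query X -> prog w (result X)
}.

Variant operation (X : dynamic_problem) : Type :=
| Update of update X
| Query of query X.

Definition state_step (X : dynamic_problem) (x : state X) (o : operation X) :
    state X :=
  match o with
  | Update u => apply_update x u
  | Query _ => x
  end.

(* A query does not change the abstract state, but it may write to memory. *)
Definition memory_step (X : dynamic_problem) (w : nat)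
    (S : data_structure X w) (M : memory w) (o : operation X) : memory w :=
  match o with
  | Update u => (exec (update_prog S u) M).2
  | Query q => (exec (query_prog S q) M).2
  end.

(* Correctness and probe bounds are required in every memory that arises from
   the initial one by an arbitrary interleaving of updates and queries. *)
Definition solves (X : dynamic_problem) (w : nat) (S : data_structure X w)
    (tu tq : nat) : Prop :=
  forall ops : seq (operation X),
    let M := foldl (memory_step S) (init_memory S) ops in
    let x := foldl (@state_step X) (init_state X) ops in
    (forall u : update X, probes (update_prog S u) M <= tu) /\
    (forall q : query X,
       probes (query_prog S q) M <= tq /\
       (exec (query_prog S q) M).1 = answer q x).

(* Rooted trees on the node set N, given by parent pointers; by convention the
   root is its own parent. *)
Record version_tree (N : finType) (U : Type) := VersionTree {
  root : N;
  parent : N -> N;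
  updates : N -> seq U;
  parent_root : parent root = root;
  root_reachable : forall v : N, fconnect parent v root
}.

(* [findex] counts the steps from v up to the first visit of the root. *)
Definition root_path (N : finType) (U : Type) (d : version_tree N U) (v : N) :
    seq N :=
  rev (traject (parent d) v (findex (parent d) v (root d)).+1).

Definition path_updates (N : finType) (U : Type) (d : version_tree N U)
    (v : N) : seq U :=
  flatten [seq updates d x | x <- root_path d v].

Definition total_updates (N : finType) (U : Type) (d : version_tree N U) : nat :=
  \sum_(v : N) size (updates d v).

Definition persistent (X : dynamic_problem) (N : finType) (m : nat)
    (q : query X * N)
    (d : {d : version_tree N (update X) | total_updates d = m}) : result X :=
  answer q.1 (foldl (@apply_update X) (init_state X) (path_updates (sval d) q.2)).

Arguments persistent : clear implicits.

(* Main.v *)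
Require Import Defs.
From mathcomp Require Import all_boot zify.
From Stdlib Require Import ClassicalEpsilon.

Set Implicit Arguments.
Unset Strict Implicit.
Unset Printing Implicit Defensive.

(** A preorder traversal of the version tree turns the memories of all versions
    into one linear history, in which a cell changes only when a node that
    writes to it is entered or left. Sorted lexicographically by (address,
    time), this history is piecewise constant with at most [2 m tu + 1] pieces.
    The code stores the time of every node and the endpoints and value of every
    piece, in [O(1)] words each. A query at a node is certified by the time of
    that node and, for every cell it reads, by the piece that covers this cell
    at that time: the verifier answers whenever all databases consistent with
    the probed cells agree, so it suffices that these cells determine the
    answer. *)

Section ConsensusVerifier.
Variables (Q D Z : Type) (f : Q -> D -> Z) (s w t : nat).
Variable T : D -> s.-tuple (word w).

Lemma probed_inj (U U' : s.-tuple (word w)) (P P' : {set 'I_s}) :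
  probed U' P' = probed U P -> P' = P /\ {in P, tnth U' =1 tnth U}.
Proof.
move=> eqU; have enumP : enum P' = enum P.
  by have := congr1 (map fst) eqU; rewrite /probed -!map_comp !map_id.
split=> [|i iP]; first by apply/setP=> i; rewrite -mem_enum enumP mem_enum.
move: eqU; rewrite /probed enumP => /eq_in_map/(_ i).
by rewrite mem_enum iP => /(_ isT)[].
Qed.

Definition consensus (q : Q) (l : seq ('I_s * word w)) (z : Z) : Prop :=
  forall (d : D) (P : {set 'I_s}), #|P| = t -> probed (T d) P = l -> f q d = z.

Definition consensus_verifier (q : Q) (l : seq ('I_s * word w)) : option Z :=
  match excluded_middle_informative (exists z, consensus q l z) with
  | left agreed => Some (sval (constructive_indefinite_description _ agreed))
  | right _ => None
  end.

Lemma consensus_verifier_sound (q : Q) (d : D) (P : {set 'I_s}) :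
  #|P| = t ->
  consensus_verifier q (probed (T d) P) = Some (f q d) \/
  consensus_verifier q (probed (T d) P) = None.
Proof.
move=> Pt; rewrite /consensus_verifier.
case: excluded_middle_informative => [agreed|_]; [left | by right].
by case: constructive_indefinite_description => z /= /(_ d P Pt erefl) ->.
Qed.

Lemma consensus_verifier_complete (q : Q) (d : D) (P : {set 'I_s}) :
  #|P| = t ->
  (forall d', {in P, tnth (T d') =1 tnth (T d)} -> f q d' = f q d) ->
  consensus_verifier q (probed (T d) P) = Some (f q d).
Proof.
move=> Pt detP; have [//|no_consensus] := consensus_verifier_sound q d Pt.
move: no_consensus; rewrite /consensus_verifier.
case: excluded_middle_informative => // -[]; exists (f q d) => d' P' _.
by case/probed_inj=> _ /detP.
Qed.

End ConsensusVerifier.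

Definition determines (Q D Z I R : Type) (f : Q -> D -> Z) (T : D -> I -> R)
    (q : Q) (d : D) (cells : {pred I}) : Prop :=
  forall d', {in cells, T d' =1 T d} -> f q d' = f q d.

Lemma superset_of_card (I : finType) (A : {set I}) (t : nat) :
  #|A| <= t <= #|I| -> exists2 B : {set I}, A \subset B & #|B| = t.
Proof.
case/andP=> At tI; have : t - #|A| <= #|~: A| by have := cardsC A; lia.
case/card_geqP=> s [s_uniq s_size sA]; exists (A :|: [set i in s]).
  exact: subsetUl.
rewrite cardsU cardsE (card_uniqP s_uniq) s_size.
have -> : A :&: [set i in s] = set0.
  apply/setP=> i; rewrite !inE; apply/negP=> /andP[iA /sA].
  by rewrite inE iA.
by rewrite cards0 subn0 subnKC.
Qed.

Lemma certificates_of_determining_sets (Q D Z : Type) (f : Q -> D -> Z)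
    (w k : nat) (J : finType) (T : D -> J -> word w) :
  (forall q d, exists2 P : {set J}, #|P| <= k & determines f T q d P) ->
  exists2 t, t <= k & has_certificates f #|J| w t.
Proof.
move=> detT; exists (minn k #|J|); first exact: geq_minl.
pose T' d := [tuple T d (enum_val i) | i < #|J|].
exists T', (consensus_verifier f (minn k #|J|) T') => q d; split.
  exact: consensus_verifier_sound.
have [P Pk detP] := detT q d.
have [|B PB Bt] := @superset_of_card _ (enum_rank @: P) (minn k #|J|).
  rewrite card_imset; last exact: enum_rank_inj.
  by rewrite card_ord geq_minr leq_min Pk max_card.
exists B; split=> //; apply: consensus_verifier_complete => // d' eqT.
apply: detP => x xP; have := eqT (enum_rank x).
by rewrite !tnth_mktuple enum_rankK; apply; apply/(subsetP PB)/imset_f.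
Qed.

Lemma injection_of_card_le (R U : finType) :
  #|R| <= #|U| -> exists g : R -> U, injective g.
Proof.
move=> RU; exists (fun x => enum_val (widen_ord RU (enum_rank x))) => x y.
by move=> /enum_val_inj/(congr1 val) /= /val_inj /enum_rank_inj.
Qed.

Lemma certificates_of_records (Q D Z : Type) (f : Q -> D -> Z) (w k c : nat)
    (I R : finType) (T : D -> I -> R) :
  #|R| <= 2 ^ (k * w) ->
  (forall q d, exists2 l : seq I, size l <= c & determines f T q d [in l]) ->
  exists2 t, t <= c * k & has_certificates f (#|I| * k) w t.
Proof.
move=> Rk detT.
have [|encode encode_inj] := @injection_of_card_le R (k.-tuple (word w)).
  by rewrite !card_tuple card_bool -expnM mulnC.
pose T' d (x : I * 'I_k) := tnth (encode (T d x.1)) x.2.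
have -> : #|I| * k = #|{: I * 'I_k}| by rewrite card_prod card_ord.
apply: (@certificates_of_determining_sets _ _ _ _ _ _ _ T') => q d.
have [l lc detl] := detT q d; exists (setX [set i in l] [set: 'I_k]).
  rewrite cardsX cardsT card_ord cardsE.
  exact: leq_mul (leq_trans (card_size l) lc) (leqnn k).
move=> d' eqT; apply: detl => i il; apply/encode_inj/eq_from_tnth => j.
by apply: (eqT (i, j)); rewrite !inE il.
Qed.

Lemma certificates_of_constant (Q D Z : Type) (f : Q -> D -> Z) (w : nat) :
  (forall q d d', f q d' = f q d) -> has_certificates f 0 w 0.
Proof.
move=> f_const; have [|t] := @certificates_of_determining_sets Q D Z f w 0
  void (fun=> of_void _).
  by move=> q d; exists set0; rewrite ?cards0 // => d' _.
by rewrite leqn0 card_void => /eqP->.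
Qed.

Section Hamming.
Variables (A : finType) (C : eqType).
Implicit Types f g h : A -> C.

Definition hamming f g : nat := \sum_a (f a != g a).

Lemma hammingC : commutative hamming.
Proof. by move=> f g; apply: eq_bigr => a _; rewrite eq_sym. Qed.

Lemma hammingxx f : hamming f f = 0.
Proof. by apply: big1 => a _; rewrite eqxx. Qed.

Lemma hamming_triangle g f h : hamming f h <= hamming f g + hamming g h.
Proof.
rewrite /hamming -big_split leq_sum // => a _.
have [->|_] := eqVneq (f a) (g a); first exact: leq_addl.
exact: leq_trans (leq_b1 _) (leq_addr _ _).
Qed.

Lemma hamming_eq0 f g : hamming f g = 0 -> f =1 g.
Proof.
move/eqP; rewrite sum_nat_eq0 => /forallP fg a; apply/eqP.
by have := fg a; rewrite eqb0 negbK.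
Qed.

Lemma hamming_update f a c : hamming f [eta f with a |-> c] <= 1.
Proof.
rewrite /hamming (bigD1 a) //= big1 ?addn0 ?leq_b1 // => b /negPf ba.
by rewrite /= ba eqxx.
Qed.

End Hamming.

Section ClosedWalks.
Variables (T : Type) (dist : T -> T -> nat).
Hypothesis distC : commutative dist.
Hypothesis dist_triangle : forall y x z, dist x z <= dist x y + dist y z.

Fixpoint walk_length (x : T) (s : seq T) : nat :=
  if s is y :: s' then dist x y + walk_length y s' else 0.

Lemma walk_length_sum (x0 x : T) (s : seq T) :
  walk_length x s =
  \sum_(0 <= j < size s) dist (nth x0 (x :: s) j) (nth x0 (x :: s) j.+1).
Proof.
elim: s x => [|y s IHs] x /=; first by rewrite big_geq.
by rewrite big_nat_recl // IHs.
Qed.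

Lemma walk_length_start (x y : T) (s : seq T) :
  walk_length x s <= dist x y + walk_length y s.
Proof.
case: s => [//|z s] /=; by rewrite addnA leq_add2r dist_triangle.
Qed.

Lemma walk_length_detour (x y z : T) (s1 s2 : seq T) :
  walk_length x (s1 ++ y :: z :: s2) <=
  walk_length x (s1 ++ y :: s2) + (dist y z).*2.
Proof.
elim: s1 x => [|u s1 IHs] x /=; last by have := IHs u; lia.
by have := walk_length_start z y s2; rewrite (distC z y); lia.
Qed.

Variables (N : finType) (par : N -> N) (r : N).
Hypothesis r_reachable : forall v, fconnect par v r.

Lemma frontier_exists (E : {pred N}) (u : N) :
  r \in E -> u \notin E -> exists2 v, v \notin E & par v \in E.
Proof.
move=> rE; have [v /andP[vE pvE] _|closedE] :=
  pickP [pred v | (v \notin E) && (par v \in E)]; first by exists v.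
case/negP; have : iter (findex par u r) par u \in E by rewrite iter_findex.
elim: (findex par u r) => //= i IHi iE; apply: IHi.
by have := closedE (iter i par u); rewrite /= iE andbT => /negbFE.
Qed.

Variables (M : N -> T) (z : T) (c : N -> nat).
Hypothesis root_cost : dist z (M r) <= c r.
Hypothesis edge_cost : forall v, v != r -> dist (M (par v)) (M v) <= c v.

Definition cheap_tour (e : seq N) : Prop :=
  [/\ uniq e, r \in e
    & walk_length z (rcons (map M e) z) <= (\sum_(v <- e) c v).*2].

Lemma cheap_tour_root : cheap_tour [:: r].
Proof.
by split; rewrite ?mem_head //= big_seq1 (distC (M r)) addn0 addnn leq_double.
Qed.

(* Inserting a node right after its parent keeps the order a preorder and
   traverses the edge between the two at most twice. *)
Lemma cheap_tour_extend (e : seq N) (u : N) :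
  cheap_tour e -> u \notin e ->
  exists2 e', cheap_tour e' & size e' = (size e).+1.
Proof.
case=> e_uniq re e_cost /(frontier_exists re)[v ve pe].
have vr : v != r by apply: contraNneq ve => ->.
case/splitPr: pe e_uniq re e_cost ve => e1 e2 e_uniq re e_cost ve.
have perm_e : perm_eq (e1 ++ par v :: v :: e2) (v :: e1 ++ par v :: e2).
  by apply/permP => x; rewrite /= !count_cat /=; lia.
exists (e1 ++ par v :: v :: e2); last exact: perm_size perm_e.
split; rewrite ?(perm_uniq perm_e) ?(perm_mem perm_e) ?inE ?re ?orbT //= ?ve //.
rewrite (perm_big _ perm_e) big_cons doubleD map_cat rcons_cat /=.
apply: leq_trans (walk_length_detour _ _ _ _ _) _.
by rewrite map_cat rcons_cat /= in e_cost; have := edge_cost vr; lia.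
Qed.

Lemma spanning_tour :
  exists2 e : seq N, perm_eq e (enum N)
    & walk_length z (rcons (map M e) z) <= (\sum_v c v).*2.
Proof.
have tour_of_size i : i < #|N| -> exists2 e, cheap_tour e & size e = i.+1.
  elim: i => [_|i IHi iN]; first by exists [:: r]; first exact: cheap_tour_root.
  have [e e_cheap e_size] := IHi (ltnW iN); rewrite -e_size.
  have [u ue] : exists u, u \notin e.
    apply/existsP; rewrite -negb_forall; apply/negP => /forallP e_full.
    have [e_uniq _ _] := e_cheap.
    move: iN; rewrite -e_size -(card_uniqP e_uniq) ltnNge subset_leq_card //.
    exact/subsetP.
  exact: cheap_tour_extend ue.
have N_gt0 : 0 < #|N| by apply/card_gt0P; exists r.
have [|e [e_uniq _ e_cost]] := tour_of_size #|N|.-1; first by rewrite prednK.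
rewrite prednK // => e_size.
have [|||_ e_enum] := @uniq_min_size _ e (enum N); rewrite -?cardE ?e_size //.
  by move=> v _; rewrite mem_enum.
have e_perm : perm_eq e (enum N) by apply: uniq_perm; rewrite ?enum_uniq.
by exists e; rewrite // -big_enum -(perm_big _ e_perm).
Qed.

Lemma tree_schedule (n := #|N|.+1) :
  exists (H : nat -> T) (time : N -> 'I_n),
    [/\ H 0 = z, H n = z, forall v, H (time v) = M v
      & \sum_(0 <= j < n) dist (H j) (H j.+1) <= (\sum_v c v).*2].
Proof.
have [e e_perm e_cost] := spanning_tour.
have e_size : size e = #|N| by rewrite (perm_size e_perm) cardE.
have mem_e v : v \in e by rewrite (perm_mem e_perm) mem_enum.
exists (nth z (z :: rcons (map M e) z)), (fun v => inord (index v e).+1).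
split=> [//||v|].
- by rewrite /= nth_rcons size_map e_size ltnn eqxx.
- rewrite inordK; last by rewrite ltnS -e_size index_mem.
  rewrite /= nth_rcons size_map index_mem mem_e.
  by rewrite (nth_map v) ?index_mem ?nth_index.
by move: e_cost; rewrite (walk_length_sum z) size_rcons size_map e_size.
Qed.

End ClosedWalks.

Section PiecewiseConstant.
Variable V : eqType.
Implicit Types h : nat -> V.

Definition changes h n : nat := \sum_(0 <= x < n) (h x != h x.+1).

Lemma changesS h n : changes h n.+1 = changes h n + (h n != h n.+1).
Proof. exact: big_nat_recr. Qed.

Lemma changes_homo h : {homo changes h : x y / x <= y}.
Proof.
apply: homo_leq leqnn leq_trans _ => n; by rewrite changesS leq_addr.
Qed.

Lemma eq_of_changes_eq h x y : x <= y -> changes h x = changes h y -> h x = h y.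
Proof.
elim: y => [|y IHy]; first by rewrite leqn0 => /eqP->.
rewrite leq_eqVlt => /orP[/eqP->//|]; rewrite ltnS => xy.
have := changes_homo h xy; rewrite changesS => c_le c_eq.
by rewrite IHy //; case: eqP c_eq => //= _; lia.
Qed.

(* The [i]-th piece consists of the positions preceded by [i] changes. *)
Lemma piecewise_constant h n :
  exists lo : nat -> nat,
    [/\ forall i, lo i <= n,
        forall i x, lo i <= x < lo i.+1 -> h x = h (lo i)
      & forall x, x < n -> exists2 i, i <= changes h n & lo i <= x < lo i.+1].
Proof.
pose lo i := find (fun x => i <= changes h x) (iota 0 n).
have lo_le i : lo i <= n by rewrite -[leqRHS](size_iota 0) find_size.
have lo_leE i x : x < n -> (lo i <= x) = (i <= changes h x).
  move=> xn; apply/idP/idP=> [lo_x|]; last first.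
    apply: contraLR; rewrite -ltnNge => /(before_find 0).
    by rewrite nth_iota // => ->.
  apply: leq_trans (changes_homo h lo_x).
  have := @nth_find _ 0 (fun x => i <= changes h x) (iota 0 n).
  rewrite has_find size_iota -/(lo i) (leq_ltn_trans lo_x xn) => /(_ isT).
  by rewrite nth_iota // (leq_ltn_trans lo_x xn).
exists lo; split=> // [i x /andP[lo_x x_lo]|x xn].
  have xn : x < n := leq_trans x_lo (lo_le _).
  have lo_n : lo i < n := leq_ltn_trans lo_x xn.
  apply/esym/eq_of_changes_eq => //.
  apply/eqP; rewrite eqn_leq changes_homo //=.
  have i_le : i <= changes h (lo i) by rewrite -lo_leE.
  by apply: leq_trans i_le; rewrite leqNgt -(lo_leE i.+1) // -ltnNge.
exists (changes h x); first exact: changes_homo (ltnW xn).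
by rewrite ltnNge !lo_leE // leqnn ltnn.
Qed.

End PiecewiseConstant.

Definition concat_blocks (V : Type) (g : nat -> nat -> V) (n x : nat) : V :=
  g (x %/ n) (x %% n).

Lemma concat_blocksE (V : Type) (g : nat -> nat -> V) (n i j : nat) :
  j < n -> concat_blocks g n (i * n + j) = g i j.
Proof.
move=> jn; rewrite /concat_blocks modnMDl modn_small //.
by rewrite divnMDl ?(leq_ltn_trans _ jn) // divn_small // addn0.
Qed.

Lemma changes_concat_blocks (V : eqType) (g : nat -> nat -> V) (n b : nat) :
  0 < n -> (forall i, g i n = g i.+1 0) ->
  changes (concat_blocks g n) (b * n) = \sum_(0 <= i < b) changes (g i) n.
Proof.
move=> n_gt0 gn; rewrite /changes big_nat_mul; apply: eq_bigr => i _.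
rewrite -{1}[i * n]add0n big_addn mulSn addnK; apply: eq_big_nat => j /= jn.
rewrite addnC concat_blocksE // -addnS; congr (_ != _ : nat).
have [/concat_blocksE->//|nj] := ltnP j.+1 n.
have -> : j.+1 = n by apply/eqP; rewrite eqn_leq jn.
by rewrite gn -mulSnr -[_ * n]addn0 concat_blocksE.
Qed.

(* A half-open interval of coordinates and the value taken on it. *)
Definition piece (b : nat) (C : Type) : Type :=
  ('I_b.+1 * 'I_b.+1 * option C)%type.

Definition covers (b : nat) (C : Type) (p : piece b C) (x : nat) : bool :=
  p.1.1 <= x < p.1.2.

Definition coordinate (A : finType) (n : nat) (a : A) (j : nat) : nat :=
  enum_rank a * n + j.

Section LexicographicHistory.
Variables (A : finType) (C : eqType) (z : A -> C) (n : nat).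
Variable H : nat -> A -> C.

(* Coding the content [z a] by [None] makes the histories of all cells start
   and end with the same value, so that no change occurs between two cells. *)
Definition deviation (j : nat) (a : A) : option C :=
  if H j a == z a then None else Some (H j a).

Definition deviation_block (i j : nat) : option C :=
  nth None (map (deviation j) (enum A)) i.

Definition lex_history : nat -> option C := concat_blocks deviation_block n.

Lemma deviationK (j : nat) (a : A) : odflt (z a) (deviation j a) = H j a.
Proof. by rewrite /deviation; case: eqP. Qed.

Lemma deviation_block_rank (a : A) (j : nat) :
  deviation_block (enum_rank a) j = deviation j a.
Proof.
by rewrite /deviation_block (nth_map a) -?cardE // -enum_val_nth enum_rankK.
Qed.

Lemma deviation_block_None (i j : nat) : H j = z -> deviation_block i j = None.
Proof.
move=> Hj; rewrite /deviation_block /deviation Hj.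
by elim: (enum A) i => [|a s IHs] [|i] //=; rewrite ?IHs ?eqxx.
Qed.

Lemma lex_history_coordinate (a : A) (j : nat) :
  j < n -> lex_history (coordinate n a j) = deviation j a.
Proof.
by move=> jn; rewrite /lex_history concat_blocksE // deviation_block_rank.
Qed.

Hypothesis n_gt0 : 0 < n.
Hypothesis H_start : H 0 = z.
Hypothesis H_end : H n = z.

Lemma changes_lex_history :
  changes lex_history (#|A| * n) <=
  \sum_(0 <= j < n) hamming (H j) (H j.+1).
Proof.
rewrite changes_concat_blocks // => [|i]; last by rewrite !deviation_block_None.
rewrite exchange_big; apply: leq_sum => j _.
rewrite big_mkord (reindex _ (onW_bij _ (@enum_rank_bij A))).
apply: leq_sum => a _; rewrite !deviation_block_rank /deviation.
by have [->|] := eqVneq (H j a) (H j.+1 a); rewrite ?eqxx // leq_b1.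
Qed.

Lemma history_pieces :
  exists F : nat -> piece (#|A| * n) C,
    (forall i a j, j < n -> covers (F i) (coordinate n a j) ->
       H j a = odflt (z a) (F i).2) /\
    (forall (a : A) j, j < n ->
       exists2 i, i <= \sum_(0 <= l < n) hamming (H l) (H l.+1)
         & covers (F i) (coordinate n a j)).
Proof.
have [lo [lo_le lo_const lo_cover]] :=
  piecewise_constant lex_history (#|A| * n).
exists (fun i => (inord (lo i), inord (lo i.+1), lex_history (lo i))).
split=> [i a j jn|a j jn].
  rewrite /covers /= !inordK ?ltnS // => /lo_const <-.
  by rewrite lex_history_coordinate // deviationK.
have coordinate_lt : coordinate n a j < #|A| * n.
  apply: leq_trans (leq_mul (ltn_ord (enum_rank a)) (leqnn n)).
  by rewrite mulSnr ltn_add2l.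
have [i i_le i_cover] := lo_cover _ coordinate_lt.
exists i; first exact: leq_trans changes_lex_history.
by rewrite /covers /= !inordK ?ltnS.
Qed.

End LexicographicHistory.

Section HistoryTables.
Variables (N A : finType) (C : Type) (k : nat).

Definition entry : Type := ('I_#|N|.+1 + piece (#|A| * #|N|.+1) C)%type.

Record history_table : Type := HistoryTable {
  node_time : N -> 'I_#|N|.+1;
  pieces : 'I_k -> piece (#|A| * #|N|.+1) C
}.

Definition covering (tab : history_table) (v : N) (a : A) (i : 'I_k) : bool :=
  covers (pieces tab i) (coordinate #|N|.+1 a (node_time tab v)).

Definition represents (tab : history_table) (z : A -> C) (M : N -> A -> C) :
    Prop :=
  (forall v a i, covering tab v a i -> M v a = odflt (z a) (pieces tab i).2) /\
  (forall v a, exists i, covering tab v a i).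

Definition table_entry (tab : history_table) (x : N + 'I_k) : entry :=
  match x with
  | inl v => inl (node_time tab v)
  | inr i => inr (pieces tab i)
  end.

Lemma represents_locally (z : A -> C) (M : N -> A -> C) (tab : history_table)
    (v : N) (l : seq A) :
  represents tab z M ->
  exists2 entries : seq (N + 'I_k), size entries <= (size l).+1
    & forall tab' M', represents tab' z M' ->
        {in entries, table_entry tab' =1 table_entry tab} ->
        {in l, M' v =1 M v}.
Proof.
case=> tabM /(_ v)/fin_all_exists[piece_of piece_ofP].
pose entries : seq (N + 'I_k) := inl v :: [seq inr (piece_of a) | a <- l].
exists entries; first by rewrite /= size_map.
move=> tab' M' [tabM' _] eq_tab a al.
have [eq_time] := eq_tab (inl v) (mem_head _ _).
have /eq_tab[eq_piece] : inr (piece_of a) \in entries.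
  by rewrite inE; apply/orP; right; apply: map_f.
rewrite (tabM v a (piece_of a)) // (tabM' v a (piece_of a)) ?eq_piece //.
by rewrite /covering eq_time eq_piece; apply: piece_ofP.
Qed.

End HistoryTables.

Lemma tree_history_table (N A : finType) (C : eqType) (par : N -> N) (r : N)
    (M : N -> A -> C) (z : A -> C) (c : N -> nat) :
  (forall v, fconnect par v r) ->
  hamming z (M r) <= c r ->
  (forall v, v != r -> hamming (M (par v)) (M v) <= c v) ->
  exists tab : history_table N A C (\sum_v c v).*2.+1, represents tab z M.
Proof.
move=> reach root_cost edge_cost.
have [H [time [H0 Hn H_time H_cost]]] := tree_schedule (@hammingC A C)
  (@hamming_triangle A C) reach root_cost edge_cost.
have [F [F_content F_cover]] := history_pieces (ltn0Sn _) H0 Hn.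
exists (HistoryTable time (fun i => F i)); split=> [v a i|v a].
  by move/F_content => <- //; rewrite H_time.
have [//|i i_le i_cover] := F_cover a (time v).
by exists (Ordinal (leq_ltn_trans i_le (H_cost : _ < _.+1))).
Qed.

Lemma entry_count_le (n E W : nat) :
  0 < n -> n <= E -> 1 < W ->
  n + (W * n).+1 * (W * n).+1 * W.+1 <= E ^ 2 * W ^ 7.
Proof.
move=> n_gt0 nE W_gt1; have W1_le : W.+1 <= W * W by nia.
have end_le : (W * n).+1 <= W * W * E by nia.
have time_le : n <= E * E * W ^ 6.
  rewrite (leq_trans nE) // -mulnA leq_pmulr // muln_gt0 expn_gt0.
  by rewrite (leq_trans n_gt0 nE) (ltnW W_gt1).
have piece_le : (W * n).+1 * (W * n).+1 * W.+1 <= E * E * W ^ 6.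
  apply: leq_trans (leq_mul (leq_mul end_le end_le) W1_le) _.
  by apply: eq_leq; rewrite !expnS expn0; lia.
apply: leq_trans (leq_add time_le piece_le) _.
by rewrite addnn -mul2n (expnS W 6) -mulnn [leqRHS]mulnCA leq_mul2r W_gt1 orbT.
Qed.

Definition words_per_entry (e : nat) : nat := e.*2 + 7.

Lemma card_entry_le (N : finType) (w e : nat) :
  0 < w -> #|N|.+1 <= 2 ^ (e * w) ->
  #|{: entry N (word w) (word w)}| <= 2 ^ (words_per_entry e * w).
Proof.
move=> w_gt0 N_lt; rewrite card_sum !card_prod !card_ord card_option.
rewrite card_tuple card_bool.
have -> : 2 ^ (words_per_entry e * w) = (2 ^ (e * w)) ^ 2 * (2 ^ w) ^ 7.
  by rewrite -!expnM -expnD; congr (_ ^ _); rewrite /words_per_entry; lia.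
by apply: entry_count_le; rewrite // -{1}(expn1 2) leq_pexp2l.
Qed.

Section Programs.
Variables (w : nat) (B : Type).
Implicit Types (p : prog w B) (M : memory w).

Lemma hamming_exec p M : hamming M (exec p M).2 <= probes p M.
Proof.
elim: p M => [x|a k IHk|a c p IHp] M /=; first by rewrite hammingxx.
  exact: leqW (IHk _ _).
apply: leq_trans (hamming_triangle [eta M with a |-> c] _ _) _.
by rewrite -add1n leq_add ?hamming_update.
Qed.

Fixpoint reads p M : seq (word w) :=
  match p with
  | Ret _ => [::]
  | Read a k => a :: reads (k (M a)) M
  | Write a c p' => reads p' [eta M with a |-> c]
  end.

Lemma size_reads p M : size (reads p M) <= probes p M.
Proof.
elim: p M => [x|a k IHk|a c p IHp] M //=; first exact: IHk.
exact: leqW (IHp _).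
Qed.

Lemma exec_eq_on_reads p M M' :
  {in reads p M, M' =1 M} -> (exec p M').1 = (exec p M).1.
Proof.
elim: p M M' => [//|a k IHk|a c p IHp] M M' /= eqM.
  rewrite eqM ?mem_head //; apply: IHk => b bl.
  by apply: eqM; rewrite inE bl orbT.
by apply: IHp => b bl /=; rewrite eqM.
Qed.

End Programs.

Section VersionTrees.
Variables (N : finType) (U : Type) (d : version_tree N U).

Lemma path_updates_root :
  path_updates d (Defs.root d) = updates d (Defs.root d).
Proof. by rewrite /path_updates /root_path findex0 /= cats0. Qed.

Lemma path_updates_parent (v : N) : v != Defs.root d ->
  path_updates d v = path_updates d (parent d v) ++ updates d v.
Proof.
rewrite eq_sym /path_updates /root_path => vr.
rewrite (fconnect_findex (root_reachable d v) vr).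
by rewrite trajectS rev_cons map_rcons flatten_rcons.
Qed.

Lemma path_updates_nil (v : N) : total_updates d = 0 -> path_updates d v = [::].
Proof.
move=> /eqP; rewrite sum_nat_eq0 => /forallP no_updates; rewrite /path_updates.
elim: (root_path d v) => //= x s ->.
by have := no_updates x; case: (updates d x).
Qed.

End VersionTrees.

Section PersistentCertificates.
Variables (X : dynamic_problem) (w tu tq : nat) (S : data_structure X w).
Hypothesis S_solves : solves S tu tq.

Definition run_updates (us : seq (update X)) : memory w :=
  foldl (memory_step S) (init_memory S) (map (@Update X) us).

Lemma run_updates_rcons (us : seq (update X)) (u : update X) :
  run_updates (rcons us u) = (exec (update_prog S u) (run_updates us)).2.
Proof. by rewrite /run_updates map_rcons foldl_rcons. Qed.

Lemma probes_query (us : seq (update X)) (q : query X) :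
  probes (query_prog S q) (run_updates us) <= tq.
Proof. by have [_ /(_ q)[]] := S_solves (map (@Update X) us). Qed.

Lemma exec_query (us : seq (update X)) (q : query X) :
  (exec (query_prog S q) (run_updates us)).1 =
  answer q (foldl (@apply_update X) (init_state X) us).
Proof.
have [_ /(_ q)[_ ->]] := S_solves (map (@Update X) us); congr answer.
by elim: us (init_state X) => /=.
Qed.

Lemma hamming_run_updates (us vs : seq (update X)) :
  hamming (run_updates us) (run_updates (us ++ vs)) <= size vs * tu.
Proof.
elim/last_ind: vs => [|vs u IHvs]; first by rewrite cats0 hammingxx.
rewrite -rcons_cat size_rcons mulSnr.
apply: leq_trans (hamming_triangle (run_updates (us ++ vs)) _ _) _.
rewrite leq_add // run_updates_rcons (leq_trans (hamming_exec _ _)) //.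
by have [+ _] := S_solves (map (@Update X) (us ++ vs)); apply.
Qed.

Variables (N : finType) (m : nat).
Implicit Types (v : N) (q : query X).

Local Notation database :=
  {d : version_tree N (update X) | total_updates d = m}.

Definition version_memory (d : version_tree N (update X)) v : memory w :=
  run_updates (path_updates d v).

Lemma persistentE q v (d : database) :
  persistent X N m (q, v) d =
  (exec (query_prog S q) (version_memory (sval d) v)).1.
Proof. by rewrite exec_query. Qed.

Lemma version_history_table (d : version_tree N (update X)) :
  total_updates d = m ->
  exists tab : history_table N (word w) (word w) (m * tu).*2.+1,
    represents tab (init_memory S) (version_memory d).
Proof.
move=> <-; rewrite /total_updates big_distrl /=.
apply: tree_history_table (root_reachable d) _ _ => [|v vr].
  rewrite /version_memory path_updates_root.
  exact: hamming_run_updates [::] _.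
rewrite /version_memory (path_updates_parent vr).
exact: hamming_run_updates.
Qed.

(* Either all memories that arise are equal or queries ignore them. *)
Lemma persistent_constant q v (d d' : database) :
  [|| m == 0, tu == 0, tq == 0 | w == 0] ->
  persistent X N m (q, v) d' = persistent X N m (q, v) d.
Proof.
move=> degenerate; rewrite !persistentE; apply: exec_eq_on_reads => a a_read.
case/or4P: degenerate => /eqP degenerate.
- by rewrite /version_memory !path_updates_nil ?(svalP d) ?(svalP d').
- have init_run us : run_updates [::] =1 run_updates us.
    apply: hamming_eq0; apply/eqP; rewrite -leqn0.
    by have := hamming_run_updates [::] us; rewrite degenerate muln0.
  by rewrite /version_memory -!init_run.
- have := leq_trans (size_reads _ _) (probes_query (path_updates (sval d) v) q).
  by rewrite degenerate leqn0 => /nilP no_reads; rewrite no_reads in a_read.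
by apply: eq_from_tnth => i; have := ltn_ord i; rewrite {2}degenerate.
Qed.

Lemma persistent_certificates (e : nat) :
  0 < w -> #|N|.+1 <= 2 ^ (e * w) ->
  exists2 t, t <= tq.+1 * words_per_entry e
    & has_certificates (persistent X N m)
        ((#|N| + (m * tu).*2.+1) * words_per_entry e) w t.
Proof.
move=> w_gt0 /(card_entry_le w_gt0) entry_le.
have /(_ _)/constructive_indefinite_description table
  (d : database) := version_history_table (svalP d).
have -> : #|N| + (m * tu).*2.+1 = #|{: N + 'I_(m * tu).*2.+1}|.
  by rewrite card_sum card_ord.
pose T d := table_entry (sval (table d)).
apply: (certificates_of_records (T := T) entry_le) => -[q v] d.
pose l := reads (query_prog S q) (version_memory (sval d) v).
have [entries entries_size local] := represents_locally v l (svalP (table d)).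
exists entries; first apply: leq_trans entries_size _.
  exact: leq_trans (size_reads _ _) (probes_query _ q).
move=> d' eq_entries; rewrite !persistentE; apply: exec_eq_on_reads.
exact: local (svalP (table d')) eq_entries.
Qed.

End PersistentCertificates.

Lemma node_count_lt_pow (K L w m n : nat) :
  0 < m -> 0 < w -> up_log 2 m <= K * w -> n <= L * m.+1 ->
  n < 2 ^ ((L.*2 + K) * w).
Proof.
move=> m_gt0 w_gt0 mw nm.
have m_le : m <= 2 ^ (K * w).
  by apply: leq_trans (up_logP m (isT : 1 < 2)) _; rewrite leq_pexp2l.
have L_le : L.*2.+1 <= 2 ^ (L.*2 * w).
  apply: leq_trans (ltn_expl _ (isT : 1 < 2)) _.
  by rewrite leq_pexp2l // leq_pmulr.
rewrite mulnDl expnD; apply: leq_trans (leq_mul L_le m_le); nia.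
Qed.

(* K and L are the constants of w = Omega(lg m) and of the bound O(m) on the
   number of nodes of the version tree. *)
Theorem theorem1 (K L : nat) :
  exists C : nat,
  forall (X : dynamic_problem) (w tu tq m : nat) (N : finType)
         (A : data_structure X w),
    solves A tu tq ->
    up_log 2 m <= K * w ->
    #|N| <= L * m.+1 ->
    exists s t : nat,
      [/\ s <= C * (m * tu), t <= C * tq
        & has_certificates (persistent X N m) s w t].
Proof.
pose k := words_per_entry (L.*2 + K).
exists (k * (L.*2 + 3)) => X w tu tq m N A solA mw Nm.
have [degenerate|] := boolP [|| m == 0, tu == 0, tq == 0 | w == 0].
  exists 0, 0; split=> //; apply: certificates_of_constant => -[q v] d d'.
  exact: (persistent_constant solA).
rewrite !negb_or -!lt0n => /and4P[m_gt0 tu_gt0 tq_gt0 w_gt0].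
have [t t_le cert] := persistent_certificates solA m w_gt0
  (node_count_lt_pow m_gt0 w_gt0 mw Nm).
exists ((#|N| + (m * tu).*2.+1) * k), t; split=> //.
  have mtu_gt0 : 0 < m * tu by rewrite muln_gt0 m_gt0.
  have N_le : #|N| <= L.*2 * (m * tu) by nia.
  by rewrite mulnC -mulnA leq_mul2l; apply/orP; right; lia.
apply: leq_trans t_le _.
by rewrite mulnC -mulnA leq_mul2l; apply/orP; right; nia.
Qed.
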